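(* Let $R$ be a commutative ring with identity and $N$ a proper submodule of a unital $R$-module $M$. If $N$ is a semi $n$-submodule of $M$, then for every $r\in R$ and every submodule $K$ of $M$, the conditions $r^{2}K\subseteq N$, $r\notin\sqrt{0}$ and $T(K)=\{0_M\}$ imply $rK\subseteq N$. Moreover, the converse holds if $R$ is an integral domain; that is, if $R$ is an integral domain and for every $r\in R$ and every submodule $K$ of $M$ the conditions $r^{2}K\subseteq N$, $r\notin\sqrt{0}$ and $T(K)=\{0_M\}$ imply $rK\subseteq N$, then $N$ is a semi $n$-submodule of $M$.
   Context: $\sqrt{0}$ is the nilradical of $R$; $Ann_R(m)=\{r\in R: rm=0\}$. For an $R$-module $K$, $T(K)$ is the set of torsion elements of $K$, i.e. of those $k\in K$ for which there is a nonzero $r\in R$ with $rk=0$. A proper submodule $N$ of $M$ is called a semi $n$-submodule if whenever $r\in R$, $m\in M$ with $r^{2}m\in N$, $r\notin\sqrt{0}$ and $Ann_R(m)=0$, then $rm\in N$. *)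

(* Defs.v *)
From mathcomp Require Import all_boot all_algebra.
From mathcomp Require Import boolp classical_sets.

Set Implicit Arguments.
Unset Strict Implicit.
Unset Printing Implicit Defensive.

Import GRing.Theory.

Local Open Scope classical_set_scope.
Local Open Scope ring_scope.

Definition nilradical (R : comPzRingType) : set R :=
  [set r | exists n : nat, r ^+ n = 0].

Definition ann (R : comPzRingType) (M : lmodType R) (m : M) : set R :=
  [set r | r *: m = 0].

Definition torsion (R : comPzRingType) (M : lmodType R) (K : set M) : set M :=
  [set k | K k /\ exists2 r : R, r != 0 & r *: k = 0].

(* Arbitrary subsets of M are Prop-valued; the library's closure predicate sees
   them through the classical membership [_ \in N]. *)
Definition submodule (R : comPzRingType) (M : lmodType R) (N : set M) : Prop :=
  submod_closed [in N].

Definition proper_submodule (R : comPzRingType) (M : lmodType R) (N : set M) :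
    Prop :=
  submodule N /\ N `<` setT.

Definition semi_n_submodule (R : comPzRingType) (M : lmodType R) (N : set M) :
    Prop :=
  proper_submodule N /\
  forall (r : R) (m : M),
    N (r ^+ 2 *: m) -> ~ nilradical r -> ann m = [set 0] -> N (r *: m).

Definition integral_domain (R : comPzRingType) : Prop :=
  (1 : R) != 0 /\ GRing.integral_domain_axiom R.

(* Main.v *)
Require Import Defs.
From mathcomp Require Import all_boot all_algebra.
From mathcomp Require Import boolp classical_sets.

Local Open Scope classical_set_scope.
Local Open Scope ring_scope.

Import GRing.Theory.

(** Both directions trade elements with zero annihilator for torsion-free submodules. A nonzero
    element of a torsion-free [K] has zero annihilator ([ann_torsion_free]), so the condition on [N]
    applies to it elementwise. Conversely, over a domain, an [m] with zero annihilator spans a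
    torsion-free cyclic submodule ([torsion_cyclic]), and the hypothesis for [K] = [R m] gives back
    the elementwise condition. *)

Lemma submodule0 (R : comPzRingType) (M : lmodType R) (N : set M) :
  submodule N -> N 0.
Proof. by case=> N0 _; apply/set_mem. Qed.

Lemma submoduleZ (R : comPzRingType) (M : lmodType R) (N : set M) (a : R)
    (m : M) :
  submodule N -> N m -> N (a *: m).
Proof.
case=> N0 Nlin Nm; apply/set_mem; rewrite -[a *: m]addr0.
by apply: Nlin => //; apply/mem_set.
Qed.

Lemma submodule_cyclic (R : comPzRingType) (M : lmodType R) (m : M) :
  submodule (range (fun a : R => a *: m)).
Proof.
split; first by apply/mem_set; exists 0; rewrite ?scale0r.
move=> c _ _ /set_mem[a _ <-] /set_mem[b _ <-]; apply/mem_set.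
by exists (c * a + b) => //; rewrite scalerDl scalerA.
Qed.

Lemma ann_torsion_free (R : comPzRingType) (M : lmodType R) (K : set M)
    (k : M) :
  torsion K = [set 0] -> K k -> k != 0 -> ann k = [set 0].
Proof.
move=> K_tf Kk k_neq0; apply/seteqP; split=> [r rk0|_ ->]; last exact: scale0r.
apply: contra_notP (negP k_neq0) => /eqP r_neq0; apply/eqP.
by have : torsion K k by [split=> //; exists r]; rewrite K_tf.
Qed.

(** If [r *: (a *: m) = 0] then [r * a] annihilates [m], so [r * a = 0]; without zero divisors,
    [r != 0] forces [a = 0]. *)
Lemma torsion_cyclic (R : comPzRingType) (M : lmodType R) (m : M) :
  integral_domain R -> ann m = [set 0] ->
  torsion (range (fun a : R => a *: m)) = [set 0].
Proof.
case=> R_neq0 R_dom ann_m; apply/seteqP; split=> [_ [[a _ <-] [r r_neq0]]|_ ->].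
- rewrite scalerA => ram0; have : ann m (r * a) by [].
  rewrite ann_m => /R_dom; rewrite (negPf r_neq0) => /eqP ->.
  exact: scale0r.
- split; first by apply: submodule0; exact: submodule_cyclic.
  (* That [0] is itself torsion requires a nonzero scalar: [1] serves, as a domain is nontrivial. *)
  by exists 1; rewrite ?scaler0.
Qed.

Theorem theorem2 (R : comPzRingType) (M : lmodType R) (N : set M)
    (N_proper : proper_submodule N) :
  (semi_n_submodule N ->
   forall (r : R) (K : set M), submodule K ->
     [set r ^+ 2 *: k | k in K] `<=` N -> ~ nilradical r ->
     torsion K = [set 0] ->
     [set r *: k | k in K] `<=` N)
  /\
  (integral_domain R ->
   (forall (r : R) (K : set M), submodule K ->
      [set r ^+ 2 *: k | k in K] `<=` N -> ~ nilradical r ->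
      torsion K = [set 0] ->
      [set r *: k | k in K] `<=` N) ->
   semi_n_submodule N).
Proof.
have [N_sub _] := N_proper; split.
- move=> [_ N_semi] r K _ r2K r_nnil K_tf _ [k Kk <-].
  (* The case [k = 0] is separate because [ann 0] is the whole ring. *)
  have [->|k_neq0] := eqVneq k 0; first by rewrite scaler0; exact: submodule0.
  apply: N_semi => //; first by apply: r2K; exists k.
  exact: ann_torsion_free K_tf Kk k_neq0.
- move=> R_dom N_semi; split=> // r m r2m r_nnil ann_m.
  apply: (N_semi r (range (fun a : R => a *: m))) => //.
  + exact: submodule_cyclic.
  + move=> _ [_ [a _ <-] <-].
    (* By commutativity [r ^+ 2 *: (a *: m)] is [a *: (r ^+ 2 *: m)], a multiple of an element of
       [N]. *)
    by rewrite scalerA mulrC -scalerA; exact: submoduleZ.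
  + exact: torsion_cyclic.
  + by exists m => //; exists 1; rewrite ?scale1r.
Qed.
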